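(* Let $c\ge 1$ be an integer and let $P$ be a set partition of $S_c$. Let $D\subseteq S_c$ be the set of permutations that are lexicographically smaller than every other permutation in their part of $P$, and let $U=S_c\setminus D$. For each positive integer $n$ let $N_n$ be the number of equivalence classes of $S_n$ under $P$-equivalence, and let $A_n$ be the number of permutations in $S_n$ that avoid every permutation in $U$. Let $k\ge 2c-1$ be an integer. If $N_k=A_k$, then $N_n=A_n$ for all $n\ge k$.
   Context: Permutations in $S_n$ are written as words $\pi_1\pi_2\cdots\pi_n$ in one-line notation. The order permutation of a word $u$ of $c$ distinct positive integers is the unique $\sigma\in S_c$ with $\sigma_i<\sigma_j$ iff $u_i<u_j$. The $P$-equivalence on $S_n$ is the equivalence relation generated by: $\phi\equiv\psi$ whenever $\phi=aub$ and $\psi=avb$ (concatenations) for some possibly empty words $a,b$ and words $u,v$ of length $c$ (so $u,v$ occupy the same $c$ consecutive positions) such that the order permutations of $u$ and $v$ lie in the same part of $P$. All equivalence classes are counted, including one-element classes. A permutation $w\in S_n$ avoids $\pi\in S_c$ if no factor of $w$ (block of letters in consecutive positions) has order permutation $\pi$; avoidance is thus in the consecutive sense. A permutation that is alone in its part of $P$ belongs to $D$. *)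

(* Defs.v *)
From mathcomp Require Import all_boot all_order all_fingroup.

Set Implicit Arguments.
Unset Strict Implicit.
Unset Printing Implicit Defensive.

(* Sequences are ordered lexicographically by (_ < _)%O. *)
Import Order.DefaultSeqLexiOrder.

(* One-line notation.  A permutation of 'I_n is 0-based; the letters of its
   word are shifted so as to be 1, ..., n. *)
Definition word (n : nat) (w : 'S_n) : seq nat :=
  [seq (nat_of_ord (w i)).+1 | i <- enum 'I_n].

Definition is_order_perm (c : nat) (u : seq nat) (s : 'S_c) : bool :=
  (size u == c) &&
  [forall i : 'I_c, forall j : 'I_c, (s i < s j) == (nth 0 u i < nth 0 u j)].

Definition same_part (c : nat) (P : {set {set 'S_c}}) (s t : 'S_c) : bool :=
  [exists B in P, (s \in B) && (t \in B)].

(* The factor of length c starting at position p (shorter than c when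
   p + c > n, in which case it has no order permutation in 'S_c). *)
Definition factor (c p : nat) (w : seq nat) : seq nat := take c (drop p w).

(* word phi = a u b and word psi = a v b, where a has length p and the order
   permutations of u and v, of length c, lie in the same part of P. *)
Definition step (c : nat) (P : {set {set 'S_c}}) (n : nat) : rel 'S_n :=
  fun phi psi =>
    [exists p : 'I_n.+1, exists s : 'S_c, exists t : 'S_c,
      [&& take p (word phi) == take p (word psi),
          drop (p + c) (word phi) == drop (p + c) (word psi),
          is_order_perm (factor c p (word phi)) s,
          is_order_perm (factor c p (word psi)) t
        & same_part P s t]].

Arguments step {c} P n.

(* step P n is symmetric (step_sym), so that its reflexive transitive closure
   is the equivalence relation it generates. *)
Definition P_equiv (c : nat) (P : {set {set 'S_c}}) (n : nat) : rel 'S_n :=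
  connect (step P n).

Arguments P_equiv {c} P n.

Definition num_classes (c : nat) (P : {set {set 'S_c}}) (n : nat) : nat :=
  #|equivalence_partition (P_equiv P n) [set: 'S_n]|.

Definition lexlt (c : nat) (s t : 'S_c) : bool :=
  (word s < word t)%O.

Definition lex_minimal (c : nat) (P : {set {set 'S_c}}) : {set 'S_c} :=
  [set s | [forall t : 'S_c, (same_part P s t && (t != s)) ==> lexlt s t]].

Definition avoids (n c : nat) (w : 'S_n) (s : 'S_c) : bool :=
  ~~ [exists p : 'I_n.+1, is_order_perm (factor c p (word w)) s].

Definition num_avoiding (c : nat) (U : {set 'S_c}) (n : nat) : nat :=
  #|[set w : 'S_n | [forall s in U, avoids w s]]|.

Lemma size_word (n : nat) (w : 'S_n) : size (word w) = n.
Proof. by rewrite size_map -cardE card_ord. Qed.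

Lemma step_sym (c : nat) (P : {set {set 'S_c}}) (n : nat) :
  symmetric (step P n).
Proof.
suff H phi psi : step P n phi psi -> step P n psi phi.
  by move=> phi psi; apply/idP/idP; apply: H.
case/existsP=> p /existsP[s /existsP[t /and5P[a b hs ht /existsP[B]]]].
case/and3P=> BP sB tB.
apply/existsP; exists p; apply/existsP; exists t; apply/existsP; exists s.
rewrite eq_sym a eq_sym b ht hs /=.
by apply/existsP; exists B; rewrite BP tB sB.
Qed.

Lemma P_equiv_equivalence (c : nat) (P : {set {set 'S_c}}) (n : nat) :
  equivalence_rel (P_equiv P n).
Proof.
apply/equivalence_relP; split=> [w|x y xy z]; first exact: connect0.
exact: (same_connect (sym_connect_sym (@step_sym c P n)) xy).
Qed.

Lemma stepP (c : nat) (P : {set {set 'S_c}}) (n : nat) (phi psi : 'S_n) :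
  reflect
    (exists a u v b : seq nat, exists s t : 'S_c,
      [/\ word phi = a ++ u ++ b, word psi = a ++ v ++ b,
          is_order_perm u s, is_order_perm v t & same_part P s t])
    (step P n phi psi).
Proof.
apply: (iffP existsP) => [[p /existsP[s /existsP[t /and5P[]]]]|].
  move=> /eqP ha /eqP hb hs ht st.
  exists (take p (word phi)), (factor c p (word phi)),
    (factor c p (word psi)), (drop (p + c) (word phi)), s, t.
  split=> //; first by rewrite addnC -drop_drop /factor !cat_take_drop.
  by rewrite ha hb addnC -drop_drop /factor !cat_take_drop.
move=> [a [u [v [b [s [t [e1 e2 hs ht st]]]]]]].
have su : size u = c by case/andP: hs => /eqP.
have sv : size v = c by case/andP: ht => /eqP.
have sa : size a < n.+1 by rewrite ltnS -(size_word phi) e1 size_cat leq_addr.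
exists (Ordinal sa); apply/existsP; exists s; apply/existsP; exists t.
have dc (x : seq nat) : size x = c -> drop (size a + c) (a ++ x ++ b) = b.
  by move=> sx; rewrite addnC -drop_drop !drop_size_cat.
rewrite /factor /= e1 e2 !dc // !(take_size_cat _ (erefl (size a))).
rewrite !(drop_size_cat _ (erefl (size a))) !eqxx /=.
by rewrite (take_size_cat _ su) (take_size_cat _ sv) hs ht st.
Qed.

Lemma avoidsP (n c : nat) (w : 'S_n) (s : 'S_c) :
  reflect (forall u : seq nat, infix u (word w) -> ~~ is_order_perm u s)
          (avoids w s).
Proof.
apply: (iffP idP) => [/existsPn H u /infixP[a [b e]]|H].
  apply/negP=> hu.
  have sa : size a < n.+1 by rewrite ltnS -(size_word w) e size_cat leq_addr.
  have := H (Ordinal sa); rewrite /factor /= e drop_size_cat //.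
  by rewrite take_size_cat ?hu //; case/andP: hu => /eqP.
apply/existsPn=> p; apply: H; apply/infixP.
exists (take p (word w)), (drop c (drop p (word w))).
by rewrite /factor !cat_take_drop.
Qed.

Lemma ltxi_nthP (u v : seq nat) : size u = size v ->
  reflect (exists i, [/\ i < size u, nth 0 u i < nth 0 v i
                        & forall j, j < i -> nth 0 u j = nth 0 v j])
          ((u < v)%O).
Proof.
elim: u v => [|x u IH] [|y v] // => [_|[e]].
  by apply: (iffP idP) => // -[i []].
rewrite Order.SeqLexiOrder.ltxi_cons !Order.NatOrder.leEnat /=.
case: (ltngtP x y) => xy /=.
- by constructor; exists 0.
- constructor=> -[[|i] [_ /= lt eqs]]; first by rewrite ltnNge ltnW in lt.
  by have := eqs 0 isT => /= exy; rewrite exy ltnn in xy.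
- apply: (iffP (IH v e)) => -[].
    by move=> i [lt_i lt eqs]; exists i.+1; split=> // -[|j] //=; apply: eqs.
  move=> [|i] [lt_i /= lt eqs]; first by rewrite xy ltnn in lt.
  by exists i; split=> // j ji; apply: (eqs j.+1).
Qed.

Lemma nth_word (n : nat) (w : 'S_n) (i : 'I_n) :
  nth 0 (word w) i = (nat_of_ord (w i)).+1.
Proof. by rewrite (nth_map i) ?nth_ord_enum // -cardE card_ord. Qed.

Lemma lexltP (c : nat) (s t : 'S_c) :
  reflect (exists i : 'I_c, s i < t i /\ forall j : 'I_c, j < i -> s j = t j)
          (lexlt s t).
Proof.
apply: (iffP (ltxi_nthP _)); rewrite ?size_word //.
  case=> i [ic lt eqs]; exists (Ordinal ic); split.
    by move: lt; rewrite -[i]/(nat_of_ord (Ordinal ic)) !nth_word.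
  by move=> j /= /eqs; rewrite !nth_word => -[] /val_inj.
case=> i [lt eqs]; exists i; split=> //; first by rewrite !nth_word.
move=> j ji; have jc := ltn_trans ji (ltn_ord i).
by rewrite -[j]/(nat_of_ord (Ordinal jc)) !nth_word eqs.
Qed.

(* Main.v *)
From Stdlib Require Import Relation_Operators.
Require Import Defs.
From mathcomp Require Import all_boot all_order all_fingroup.
From mathcomp Require Import zify.

Set Implicit Arguments.
Unset Strict Implicit.
Unset Printing Implicit Defensive.

Import Order.DefaultSeqLexiOrder.

(** Rearranging a factor whose order permutation lies outside D so that it gets
    the order permutation in D of the same part is a rewriting rule on words.
    It decreases the word lexicographically ([red_lt]), so it terminates; its
    normal forms are the words avoiding U; and the equivalence it generates is
    the P-equivalence, since two words differing by one step have a common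
    reduct ([step_joinable]).  Hence every class contains an avoiding
    permutation, and N_n = A_n holds exactly when no class of S_n contains two
    of them ([num_classes_eq]), that is, when normal forms are unique in size n.

    It remains to carry uniqueness of normal forms from size k to any size
    n >= k ([unique_nf_ge]).  By Newman's argument, local confluence suffices.
    Two rewritings of disjoint factors commute.  Two rewritings of overlapping
    factors take place inside at most 2c - 1 <= k consecutive letters, hence
    inside a factor of length k; that factor has a unique normal form, because
    an increasing renaming of its letters turns it into a permutation of S_k
    ([unique_nf_of_eq]), and this normal form is a common reduct of the two
    results ([red_joinable_le]).

    The rewriting is set up on arbitrary words of distinct natural numbers
    rather than on S_n, so that it applies to factors directly. *)

(** * Words and their order permutations *)

Lemma size_order_perm (c : nat) (u : seq nat) (s : 'S_c) :
  is_order_perm u s -> size u = c.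
Proof. by case/andP=> /eqP. Qed.

Lemma order_permP (c : nat) (u : seq nat) (s : 'S_c) :
  is_order_perm u s ->
  forall i j : 'I_c, (s i < s j) = (nth 0 u i < nth 0 u j).
Proof. by case/andP=> _ /forallP h i j; have /forallP/(_ j)/eqP := h i. Qed.

Lemma word_inj (n : nat) : injective (@word n).
Proof.
move=> v w e; apply/permP=> i; apply: val_inj.
by have := congr1 (fun x => nth 0 x i) e; rewrite !nth_word => -[].
Qed.

Lemma perm_eq_word (n : nat) (w : 'S_n) : perm_eq (word w) (iota 1 n).
Proof.
have -> : word w = [seq (val i).+1 | i <- [seq w i | i <- enum 'I_n]].
  by rewrite -map_comp.
have -> : iota 1 n = [seq (val i).+1 | i <- enum 'I_n].
  by rewrite (map_comp S val) val_enum_ord (iotaDl 1 0 n).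
apply: perm_map; apply: uniq_perm.
- by rewrite map_inj_uniq ?enum_uniq //; apply: perm_inj.
- exact: enum_uniq.
- move=> i; rewrite mem_enum; apply/mapP; exists (w^-1%g i).
    by rewrite mem_enum.
  by rewrite permKV.
Qed.

Lemma uniq_word (n : nat) (w : 'S_n) : uniq (word w).
Proof. by rewrite (perm_uniq (perm_eq_word w)) iota_uniq. Qed.

Lemma word_of_perm_eq (n : nat) (x : seq nat) :
  perm_eq x (iota 1 n) -> exists w : 'S_n, word w = x.
Proof.
move=> px.
have sx : size x = n by rewrite (perm_size px) size_iota.
have ux : uniq x by rewrite (perm_uniq px) iota_uniq.
have bx (i : 'I_n) : 0 < nth 0 x i <= n.
  have : nth 0 x i \in x by rewrite mem_nth ?sx.
  by rewrite (perm_mem px) mem_iota add1n ltnS.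
have lx (i : 'I_n) : (nth 0 x i).-1 < n.
  by have /andP[i0 ?] := bx i; rewrite prednK.
have finj : injective (fun i : 'I_n => Ordinal (lx i)).
  move=> i j /(congr1 val) /= e; apply: ord_inj; apply/eqP.
  rewrite -(nth_uniq 0 _ _ ux) ?sx //; apply/eqP.
  have [/andP[i0 _] /andP[j0 _]] := (bx i, bx j).
  by rewrite -(prednK i0) e prednK.
exists (perm finj).
apply: (@eq_from_nth _ 0) => [|i]; first by rewrite size_word sx.
rewrite size_word => li; rewrite -[i]/(val (Ordinal li)) nth_word permE /=.
by rewrite prednK //; case/andP: (bx (Ordinal li)).
Qed.

(** A word with distinct letters is recovered from its order permutation and
    its set of letters: its i-th letter has rank s i among the letters. *)
Lemma nth_order_perm (c : nat) (u : seq nat) (s : 'S_c) (i : 'I_c) :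
  uniq u -> is_order_perm u s -> nth 0 u i = nth 0 (sort leq u) (s i).
Proof.
move=> uu us; have su := size_order_perm us; have op := order_permP us.
(* y lists the letters in the order of their ranks: it is the sorted word *)
pose y := [seq nth 0 u (s^-1%g j) | j <- enum 'I_c].
have nthy (j : 'I_c) : nth 0 y j = nth 0 u (s^-1%g j).
  by rewrite /y (nth_map j) ?nth_ord_enum // size_enum_ord.
have sy : size y = c by rewrite size_map size_enum_ord.
have yinj (j l : 'I_c) : nth 0 u (s^-1%g j) = nth 0 u (s^-1%g l) -> j = l.
  move/eqP; rewrite nth_uniq ?su // => /eqP/val_inj.
  exact: (@perm_inj _ s^-1%g).
have uy : uniq y by rewrite map_inj_uniq ?enum_uniq.
have py : perm_eq y u.
  apply: uniq_perm => // v; apply/mapP/idP => [[j _ ->]|].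
    by rewrite mem_nth ?su.
  case/(nthP 0)=> j; rewrite su => lj <-.
  by exists (s (Ordinal lj)); rewrite ?mem_enum // permK.
have -> : sort leq u = y.
  apply: (sorted_eq leq_trans anti_leq); first exact/sort_sorted/leq_total.
    have : pairwise leq y; last by rewrite -(sorted_pairwise leq_trans).
    apply/(pairwiseP 0) => j l; rewrite !inE sy => lj ll jl.
    rewrite -[j]/(val (Ordinal lj)) -[l]/(val (Ordinal ll)) !nthy ltnW //.
    by rewrite -op !permKV.
  by rewrite perm_sort perm_sym.
by rewrite nthy permK.
Qed.

Lemma order_perm_inj (c : nat) (u v : seq nat) (s : 'S_c) :
  uniq u -> perm_eq u v -> is_order_perm u s -> is_order_perm v s -> u = v.
Proof.
move=> uu uv us vs; have uvv : uniq v by rewrite -(perm_uniq uv).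
have [su sv] := (size_order_perm us, size_order_perm vs).
apply: (@eq_from_nth _ 0); first by rewrite su sv.
move=> i; rewrite su => li; rewrite -[i]/(nat_of_ord (Ordinal li)).
rewrite (nth_order_perm _ uu us) (nth_order_perm _ uvv vs).
congr (nth 0 _ _); apply/perm_sortP => //.
- exact: leq_total.
- exact: leq_trans.
- exact: anti_leq.
Qed.

(** Any set of c letters can be arranged in the relative order t. *)
Lemma rearrange (c : nat) (u : seq nat) (t : 'S_c) :
  uniq u -> size u = c -> exists2 v, perm_eq u v & is_order_perm v t.
Proof.
move=> uu su.
have sso : size (sort leq u) = c by rewrite size_sort.
have so : sorted ltn (sort leq u).
  by rewrite ltn_sorted_uniq_leq sort_uniq uu sort_sorted //; apply: leq_total.
have mono (i j : 'I_c) :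
    (nth 0 (sort leq u) i < nth 0 (sort leq u) j) = (i < j).
  have h (k l : 'I_c) : k < l -> nth 0 (sort leq u) k < nth 0 (sort leq u) l.
    by apply: (sorted_ltn_nth ltn_trans) => //; rewrite inE sso.
  case: (ltngtP i j) => [ij|ji|/val_inj ->]; last exact: ltnn.
    exact: h.
  by apply/negbTE; rewrite -leqNgt ltnW // h.
pose v := [seq nth 0 (sort leq u) (t i) | i <- enum 'I_c].
have nthv (i : 'I_c) : nth 0 v i = nth 0 (sort leq u) (t i).
  by rewrite /v (nth_map i) ?nth_ord_enum // size_enum_ord.
have sv : size v = c by rewrite size_map size_enum_ord.
exists v.
  rewrite -(perm_sort leq u); apply: uniq_perm.
  - by rewrite sort_uniq.
  - rewrite map_inj_uniq ?enum_uniq // => i j /eqP.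
    by rewrite nth_uniq ?sso ?sort_uniq // => /eqP/val_inj/perm_inj.
  - move=> x; apply/idP/mapP => [/(nthP 0)[j]|[j _ ->]].
      rewrite sso => lj <-; exists (t^-1%g (Ordinal lj)); first exact: mem_enum.
      by rewrite permKV.
    by rewrite mem_nth ?sso.
rewrite /is_order_perm sv eqxx /=.
by apply/forallP=> i; apply/forallP=> j; rewrite !nthv mono.
Qed.

Lemma lexlt_rearrange (c : nat) (u v : seq nat) (s t : 'S_c) :
  uniq u -> perm_eq u v -> is_order_perm u s -> is_order_perm v t ->
  lexlt t s -> (v < u)%O.
Proof.
move=> uu uv us vt /lexltP[i [ti eqs]].
have uvv : uniq v by rewrite -(perm_uniq uv).
have su := size_order_perm us; have sv := size_order_perm vt.
have so : sort leq v = sort leq u.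
  by apply/perm_sortP; rewrite 1?perm_sym //;
    [apply: leq_total|apply: leq_trans|apply: anti_leq].
have so' : sorted ltn (sort leq u).
  by rewrite ltn_sorted_uniq_leq sort_uniq uu sort_sorted //; apply: leq_total.
apply/ltxi_nthP; first by rewrite su sv.
exists i; split; first by rewrite sv.
  rewrite (nth_order_perm i uu us) (nth_order_perm i uvv vt) so.
  by apply: (sorted_ltn_nth ltn_trans 0 so'); rewrite ?inE ?size_sort ?su.
move=> j ji; have lj := ltn_trans ji (ltn_ord i).
rewrite -[j]/(val (Ordinal lj)).
by rewrite (nth_order_perm _ uu us) (nth_order_perm _ uvv vt) so eqs.
Qed.

(** A map that preserves the order of the letters preserves order
    permutations. *)
Lemma is_order_perm_map (c : nat) (f : nat -> nat) (u : seq nat) (s : 'S_c) :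
  {in u &, {mono f : i j / i < j}} ->
  is_order_perm (map f u) s = is_order_perm u s.
Proof.
move=> fm; rewrite /is_order_perm size_map; case: eqP => //= su.
apply: eq_forallb => i; apply: eq_forallb => j.
by rewrite !(nth_map 0) ?su // fm // mem_nth ?su.
Qed.

(** * Reduction to the smallest member of a part *)

Lemma same_part_pblock (c : nat) (P : {set {set 'S_c}}) (s t : 'S_c) :
  partition P [set: 'S_c] -> same_part P s t = (t \in pblock P s).
Proof.
case/and3P=> /eqP cP tP _; apply/existsP/idP => [[B /and3P[BP sB tB]]|ts].
  by rewrite (def_pblock tP BP sB).
exists (pblock P s); rewrite ts mem_pblock cP inE /= andbT.
by rewrite pblock_mem // cP inE.
Qed.

Lemma lex_minimal_uniq (c : nat) (P : {set {set 'S_c}}) (s t : 'S_c) :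
  same_part P s t -> s \in lex_minimal P -> t \in lex_minimal P -> s = t.
Proof.
move=> st; rewrite !inE => /forallP/(_ t)/implyP sm /forallP/(_ s)/implyP tm.
have [->//|ts] := eqVneq s t.
have st1 : lexlt s t by apply: sm; rewrite st eq_sym.
have ts1 : lexlt t s.
  apply: tm; rewrite ts andbT.
  case/existsP: st => B /and3P[BP sB tB].
  by apply/existsP; exists B; rewrite BP tB.
have := Order.POrderTheory.lt_asym (word s) (word t).
by rewrite [(_ < _)%O]st1 [(_ < _)%O]ts1.
Qed.

(** Each part has a smallest member. *)
Lemma lex_minimal_ex (c : nat) (P : {set {set 'S_c}}) (s : 'S_c) :
  partition P [set: 'S_c] ->
  exists2 t, same_part P s t & t \in lex_minimal P.
Proof.
case/and3P=> /eqP cP tP _.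
have sB : s \in pblock P s by rewrite mem_pblock cP inE.
have BP : pblock P s \in P by rewrite pblock_mem // cP inE.
have [t tB tmin] := Order.TotalTheory.arg_minP (fun t => word t) sB.
exists t; first by apply/existsP; exists (pblock P s); rewrite BP sB.
rewrite inE; apply/forallP=> t'; apply/implyP=> /andP[/existsP[B]].
case/and3P=> B'P tB' t'B' tt'; rewrite /lexlt.
rewrite Order.POrderTheory.lt_neqAle; apply/andP; split.
  by apply/eqP=> /word_inj e; rewrite e eqxx in tt'.
apply: tmin.
by rewrite -(def_pblock tP BP tB) (def_pblock tP B'P tB').
Qed.

(** A word u whose order permutation s is not the smallest of its part is
    replaced by the arrangement v of the same letters whose order permutation t
    is the smallest of that part. *)
Variant rule (c : nat) (P : {set {set 'S_c}}) (u v : seq nat) : Prop :=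
  Rule s t of perm_eq u v & is_order_perm u s & is_order_perm v t
    & same_part P s t & s \notin lex_minimal P & t \in lex_minimal P.

(** Reduction: one application of the rule to a factor.  It is defined on all
    words of natural numbers, so that it applies to a factor of a permutation
    without renaming the letters. *)
Variant red (c : nat) (P : {set {set 'S_c}}) : seq nat -> seq nat -> Prop :=
  Red a u v b of rule P u v : red P (a ++ u ++ b) (a ++ v ++ b).

Notation reds P := (clos_refl_trans_1n (seq nat) (red P)).

(** No factor has an order permutation outside the set of smallest members.
    A factor cut short by the end of x has no order permutation, so the
    positions near the end impose no condition. *)
Definition normal (c : nat) (P : {set {set 'S_c}}) (x : seq nat) : bool :=
  all (fun p => [forall s : 'S_c,
         is_order_perm (factor c p x) s ==> (s \in lex_minimal P)])
      (iota 0 (size x).+1).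

Lemma normalP (c : nat) (P : {set {set 'S_c}}) (x : seq nat) :
  reflect (forall a u b (s : 'S_c), x = a ++ u ++ b -> is_order_perm u s ->
             s \in lex_minimal P)
          (normal P x).
Proof.
apply: (iffP allP) => [H a u b s e us|H p _].
  have pa : size a \in iota 0 (size x).+1.
    by rewrite mem_iota e size_cat; lia.
  have /forallP/(_ s)/implyP := H _ pa; apply.
  by rewrite /factor e drop_size_cat // take_size_cat // (size_order_perm us).
apply/forallP=> s; apply/implyP.
apply: (H (take p x) _ (drop c (drop p x))).
by rewrite /factor !cat_take_drop.
Qed.

Lemma red_not_normal (c : nat) (P : {set {set 'S_c}}) (x y : seq nat) :
  red P x y -> ~~ normal P x.
Proof.
case=> a u v b [s t _ us _ _ sD _]; apply: contra sD => /normalP H.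
exact: H us.
Qed.

Lemma red_ex (c : nat) (P : {set {set 'S_c}}) (x : seq nat) :
  partition P [set: 'S_c] -> uniq x -> ~~ normal P x -> exists y, red P x y.
Proof.
move=> hP ux /allPn[p _ /forallPn[s]]; rewrite negb_imply => /andP[us sD].
have e : x = take p x ++ factor c p x ++ drop c (drop p x).
  by rewrite /factor !cat_take_drop.
have uu : uniq (factor c p x) by rewrite /factor take_uniq ?drop_uniq.
have [t st tD] := lex_minimal_ex s hP.
have [v uv vt] := rearrange t uu (size_order_perm us).
exists (take p x ++ v ++ drop c (drop p x)).
by rewrite {1}e; apply/Red/(Rule uv us vt st).
Qed.

Lemma red_perm_eq (c : nat) (P : {set {set 'S_c}}) (x y : seq nat) :
  red P x y -> perm_eq x y.
Proof. by case=> a u v b [s t uv *]; rewrite perm_cat2l perm_cat2r. Qed.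

Lemma ltxi_cat2l (a x y : seq nat) : (x < y)%O -> (a ++ x < a ++ y)%O.
Proof.
move=> xy; elim: a => //= i a IH.
by rewrite Order.SeqLexiOrder.ltxi_cons Order.POrderTheory.lexx.
Qed.

Lemma ltxi_catr (x y b : seq nat) :
  size x = size y -> (x < y)%O -> (x ++ b < y ++ b)%O.
Proof.
move=> sxy /(ltxi_nthP sxy)[i [li lt eqs]].
apply/ltxi_nthP; first by rewrite !size_cat sxy.
exists i; split; first by rewrite size_cat; lia.
  by rewrite !nth_cat -sxy li.
by move=> j ji; rewrite !nth_cat -sxy (ltn_trans ji li) eqs.
Qed.

Lemma red_lt (c : nat) (P : {set {set 'S_c}}) (x y : seq nat) :
  uniq x -> red P x y -> (y < x)%O.
Proof.
move=> ux r; case: r ux => a u v b [s t uv us vt st sD tD].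
rewrite !cat_uniq => /and3P[_ _ /andP[uu _]].
apply: ltxi_cat2l; apply: ltxi_catr; first by rewrite (perm_size uv).
apply: (lexlt_rearrange uu uv us vt).
have := tD; rewrite inE => /forallP/(_ s)/implyP; apply.
apply/andP; split; last by apply: contraNneq sD => ->.
have /existsP[B /and3P[BP sB tB]] := st.
by apply/existsP; exists B; rewrite BP sB tB.
Qed.

Lemma ltn_count (T : eqType) (p q : pred T) (y : T) (s : seq T) :
  subpred p q -> y \in s -> q y -> ~~ p y -> count p s < count q s.
Proof.
move=> pq + qy py; elim: s => //= i s IH; rewrite inE => /predU1P[<-|/IH lt].
  by rewrite qy (negbTE py) add0n add1n ltnS sub_count.
have : (p i <= q i)%N by case: (p i) (pq i) => // ->.
by move=> le; rewrite -addnS leq_add.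
Qed.

(** Reduction decreases a word lexicographically among the finitely many
    arrangements of its letters, hence it terminates. *)
Lemma red_wf_ind (c : nat) (P : {set {set 'S_c}}) (Q : seq nat -> Prop) :
  (forall x, uniq x -> (forall y, red P x y -> Q y) -> Q x) ->
  forall x, uniq x -> Q x.
Proof.
move=> H x; pose m x := count (fun y : seq nat => (y < x)%O) (permutations x).
have [k] := ubnP (m x); elim: k x => // k IH x mx ux.
apply: H => // y r; apply: IH; last by rewrite -(perm_uniq (red_perm_eq r)).
rewrite ltnS in mx; apply: leq_trans mx; rewrite /m.
have pxy := red_perm_eq r; have yx := red_lt ux r.
have /seq.permP -> := perm_permutations pxy.
apply: (@ltn_count _ _ _ y) => //.
- by move=> z zy; apply: Order.POrderTheory.lt_trans zy yx.
- by rewrite mem_permutations.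
- by rewrite Order.POrderTheory.ltxx.
Qed.

Lemma reds_trans (c : nat) (P : {set {set 'S_c}}) (x y z : seq nat) :
  reds P x y -> reds P y z -> reds P x z.
Proof.
elim=> {x y} // x x' y xx' _ IH yz; exact: rt1n_trans xx' (IH yz).
Qed.

Lemma red_reds (c : nat) (P : {set {set 'S_c}}) (x y : seq nat) :
  red P x y -> reds P x y.
Proof. by move=> r; apply: rt1n_trans r (rt1n_refl _ _ _). Qed.

Lemma reds_perm_eq (c : nat) (P : {set {set 'S_c}}) (x y : seq nat) :
  reds P x y -> perm_eq x y.
Proof.
by elim=> {x y} // x y z /red_perm_eq xy _; apply: perm_trans.
Qed.

Lemma reds_normal (c : nat) (P : {set {set 'S_c}}) (x y : seq nat) :
  normal P x -> reds P x y -> x = y.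
Proof. by move=> nx r; case: r nx => // y' z /red_not_normal/negP. Qed.

Lemma normal_form_ex (c : nat) (P : {set {set 'S_c}}) (x : seq nat) :
  partition P [set: 'S_c] -> uniq x -> exists2 y, reds P x y & normal P y.
Proof.
move=> hP; move: x; apply: (red_wf_ind (P := P)) => x ux IH.
have [nx|/(red_ex hP ux)[y r]] := boolP (normal P x).
  by exists x => //; apply: rt1n_refl.
have [z yz nz] := IH y r.
by exists z => //; apply: rt1n_trans r yz.
Qed.

Lemma red_cat (c : nat) (P : {set {set 'S_c}}) (a b x y : seq nat) :
  red P x y -> red P (a ++ x ++ b) (a ++ y ++ b).
Proof.
case=> a' u v b' r.
have e w : a ++ (a' ++ w ++ b') ++ b = (a ++ a') ++ w ++ (b' ++ b).
  by rewrite !catA.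
by rewrite !e; apply: Red.
Qed.

Lemma reds_cat (c : nat) (P : {set {set 'S_c}}) (a b x y : seq nat) :
  reds P x y -> reds P (a ++ x ++ b) (a ++ y ++ b).
Proof.
elim=> {x y} [x|x y z r _]; first exact: rt1n_refl.
by apply: rt1n_trans; apply: red_cat.
Qed.

Lemma red_map (c : nat) (P : {set {set 'S_c}}) (f : nat -> nat)
    (x y : seq nat) :
  {in x &, {mono f : i j / i < j}} -> red P x y -> red P (map f x) (map f y).
Proof.
move=> fm r; case: r fm => a u v b [s t uv us vt st sD tD] fm.
have fu : {in u &, {mono f : i j / i < j}}.
  by move=> i j iu ju; apply: fm; rewrite !mem_cat ?iu ?ju orbT.
have fv : {in v &, {mono f : i j / i < j}}.
  by move=> i j; rewrite -!(perm_mem uv); apply: fu.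
rewrite !map_cat; apply/Red/(Rule _ _ _ st) => //; first exact: perm_map.
  by rewrite is_order_perm_map.
by rewrite is_order_perm_map.
Qed.

Lemma reds_map (c : nat) (P : {set {set 'S_c}}) (f : nat -> nat)
    (x y : seq nat) :
  {in x &, {mono f : i j / i < j}} -> reds P x y ->
  reds P (map f x) (map f y).
Proof.
move=> fm r; elim: r fm => {x y} [x|x y z r _ IH] fm; first exact: rt1n_refl.
apply: (rt1n_trans _ _ _ _ _ (red_map fm r)); apply: IH => i j.
by rewrite -!(perm_mem (red_perm_eq r)); apply: fm.
Qed.

Lemma normal_map (c : nat) (P : {set {set 'S_c}}) (f : nat -> nat)
    (x : seq nat) :
  {in x &, {mono f : i j / i < j}} -> normal P (map f x) = normal P x.
Proof.
move=> fm; rewrite /normal size_map; apply: eq_all => p.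
apply: eq_forallb => s.
rewrite /factor -map_drop -map_take is_order_perm_map //.
by move=> i j /mem_take/mem_drop ix /mem_take/mem_drop; apply: fm.
Qed.

(** * Uniqueness of normal forms *)

(** Every word of m distinct letters has at most one normal form. *)
Definition unique_nf (c : nat) (P : {set {set 'S_c}}) (m : nat) : Prop :=
  forall x y z, uniq x -> size x = m ->
    reds P x y -> reds P x z -> normal P y -> normal P z -> y = z.

Lemma rule_size (c : nat) (P : {set {set 'S_c}}) (u v : seq nat) :
  rule P u v -> size u = c /\ size v = c.
Proof. by case=> s t _ us vt *; split; apply: size_order_perm; eassumption. Qed.

Lemma cat_eq_cat (T : Type) (a r a' r' : seq T) :
  a ++ r = a' ++ r' -> size a <= size a' ->
  exists2 m, a' = a ++ m & r = m ++ r'.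
Proof.
elim: a a' => [|i a IH] [|i' a'] //=; first by move=> ->; exists [::].
  by move=> ->; exists (i' :: a').
by case=> -> /IH{}IH /IH[m -> ->]; exists m.
Qed.

Lemma factor_in_window (T : Type) (a u b a1 w b1 : seq T) :
  a ++ u ++ b = a1 ++ w ++ b1 -> size a1 <= size a ->
  size a + size u <= size a1 + size w ->
  exists a2 b2, [/\ a = a1 ++ a2, b = b2 ++ b1 & w = a2 ++ u ++ b2].
Proof.
move=> e sa; have [a2 ea e2] := cat_eq_cat (esym e) sa.
rewrite ea size_cat -addnA leq_add2l -size_cat => sw.
have [|b2 -> ->] := cat_eq_cat (_ : (a2 ++ u) ++ b = w ++ b1) sw.
  by rewrite -catA.
by exists a2, b2; rewrite catA.
Qed.

(** Applying the rule at two places of a word gives two words with a common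
    reduct.  When the two places overlap, they lie in a factor of length k, and
    normal forms of words of length k are unique. *)
Lemma red_joinable_le (c k : nat) (P : {set {set 'S_c}})
    (a u v b a' u' v' b' : seq nat) :
  partition P [set: 'S_c] -> 2 * c - 1 <= k -> unique_nf P k ->
  rule P u v -> rule P u' v' ->
  uniq (a ++ u ++ b) -> k <= size (a ++ u ++ b) ->
  a ++ u ++ b = a' ++ u' ++ b' -> size a <= size a' ->
  exists2 d, reds P (a ++ v ++ b) d & reds P (a' ++ v' ++ b') d.
Proof.
move=> hP hk hUN r r' ux kx e aa'.
have [su sv] := rule_size r; have [su' sv'] := rule_size r'.
have [m ea' e'] := cat_eq_cat e aa'.
have [um|mu] := leqP (size u) (size m).
  (* disjoint places: the two applications commute *)
  have [m' em eb] := cat_eq_cat e' um.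
  exists (a ++ v ++ m' ++ v' ++ b').
    rewrite eb; apply: red_reds.
    have h w : a ++ v ++ m' ++ w ++ b' = (a ++ v ++ m') ++ w ++ b'.
      by rewrite !catA.
    by rewrite !h; apply: Red.
  rewrite ea' em; apply: red_reds.
  have h w : (a ++ w ++ m') ++ v' ++ b' = a ++ w ++ (m' ++ v' ++ b').
    by rewrite -!catA.
  by rewrite !h; apply: Red.
set x := a ++ u ++ b in ux kx e.
(* overlapping places span at most 2c - 1 letters; a window of length k starting
   at the first of them contains both, and it is moved left when it would exceed
   the end of the word *)
pose q := minn (size a) (size x - k).
pose w := take k (drop q x).
have qx : q + k <= size x by rewrite /q; lia.
have sw : size w = k by rewrite size_takel // size_drop; lia.
have sq : size (take q x) = q by rewrite size_takel //; lia.
have ex : x = take q x ++ w ++ drop k (drop q x) by rewrite !cat_take_drop.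
have szx : size x = size a + c + size b by rewrite !size_cat su addnA.
have szx' : size x = size a' + c + size b' by rewrite e !size_cat su' addnA.
have ma : size a' = size a + size m by rewrite ea' size_cat.
have [||a2 [b2 [ea eb ew]]] := factor_in_window (ex : a ++ u ++ b = _).
- by rewrite sq geq_minl.
- by rewrite sq sw su /q; lia.
have [||a2' [b2' [ea2 eb' ew']]] := factor_in_window (etrans (esym e) ex).
- by rewrite sq /q; lia.
- by rewrite sq sw su' /q; lia.
have uw : uniq w by rewrite take_uniq ?drop_uniq.
have red1 : red P w (a2 ++ v ++ b2) by rewrite ew; apply: Red.
have red2 : red P w (a2' ++ v' ++ b2') by rewrite ew'; apply: Red.
have uniq1 : uniq (a2 ++ v ++ b2) by rewrite -(perm_uniq (red_perm_eq red1)).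
have uniq2 : uniq (a2' ++ v' ++ b2').
  by rewrite -(perm_uniq (red_perm_eq red2)).
have [z1 wz1 nz1] := normal_form_ex hP uniq1.
have [z2 wz2 nz2] := normal_form_ex hP uniq2.
have ez : z1 = z2.
  apply: (hUN w) => //; [exact: rt1n_trans red1 wz1|exact: rt1n_trans red2 wz2].
rewrite {}ez {z1 nz1} in wz1.
exists (take q x ++ z2 ++ drop k (drop q x)).
  have -> : a ++ v ++ b = take q x ++ (a2 ++ v ++ b2) ++ drop k (drop q x).
    by rewrite {1}ea {1}eb -!catA.
  exact: reds_cat.
have -> : a' ++ v' ++ b' = take q x ++ (a2' ++ v' ++ b2') ++ drop k (drop q x).
  by rewrite {1}ea2 {1}eb' -!catA.
exact: reds_cat.
Qed.

Lemma red_joinable (c k : nat) (P : {set {set 'S_c}}) (x y z : seq nat) :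
  partition P [set: 'S_c] -> 2 * c - 1 <= k -> unique_nf P k ->
  uniq x -> k <= size x -> red P x y -> red P x z ->
  exists2 d, reds P y d & reds P z d.
Proof.
move=> hP hk hUN ux kx r1 r2; case: r1 ux kx r2 => a u v b r ux kx.
move e: (a ++ u ++ b) ux kx => w ux kx r2.
case: r2 e ux kx => a' u' v' b' r' e ux kx.
have [aa'|/ltnW a'a] := leqP (size a) (size a').
  by rewrite -e in ux kx; apply: red_joinable_le aa'; eassumption.
have [d h1 h2] :=
  red_joinable_le hP hk hUN r' r ux kx (esym e) a'a.
by exists d.
Qed.

(** Newman's lemma, with local confluence supplied by red_joinable. *)
Lemma unique_nf_ge (c k n : nat) (P : {set {set 'S_c}}) :
  partition P [set: 'S_c] -> 2 * c - 1 <= k -> unique_nf P k -> k <= n ->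
  unique_nf P n.
Proof.
move=> hP hk hUN kn x y z ux; move: x ux y z.
apply: (red_wf_ind (P := P)) => x ux IH y z sx xy xz ny nz.
case: xy ny => [|y1 y' r1 y1y'] ny; first exact: reds_normal ny xz.
case: xz nz => [|z1 z' r2 z1z'] nz.
  by case/negP: (red_not_normal r1).
have kx : k <= size x by rewrite sx.
have [d y1d z1d] := red_joinable hP hk hUN ux kx r1 r2.
have [py pz] := (red_perm_eq r1, red_perm_eq r2).
have ud : uniq d by rewrite -(perm_uniq (reds_perm_eq y1d)) -(perm_uniq py).
have [f df nf] := normal_form_ex hP ud.
have -> : y' = f.
  by apply: (IH y1 r1) (reds_trans y1d df) ny nf; rewrite -?(perm_size py).
by apply/esym/(IH z1 r2) => //; [rewrite -(perm_size pz)|apply: reds_trans df].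
Qed.

(** * Normal forms and equivalence classes *)

Lemma avoids_normal (c n : nat) (P : {set {set 'S_c}}) (w : 'S_n) :
  [forall s in ~: lex_minimal P, avoids w s] = normal P (word w).
Proof.
apply/forall_inP/normalP => [H a u b s e us|H s].
  apply: contraLR us => sD.
  have /avoidsP : avoids w s by apply: H; rewrite inE.
  by apply; apply/infixP; exists a, b.
rewrite inE => sD; apply/avoidsP=> u /infixP[a [b e]].
by apply: contra sD => us; apply: H e us.
Qed.

Lemma red_step (c n : nat) (P : {set {set 'S_c}}) (w w' : 'S_n) :
  red P (word w) (word w') -> step P n w w'.
Proof.
move=> r; apply/stepP; move ew: (word w) (word w') r => x y r.
case: r => a u v b [s t uv us vt st _ _].
by exists a, u, v, b, s, t.
Qed.

Lemma reds_P_equiv (c n : nat) (P : {set {set 'S_c}}) (w : 'S_n)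
    (y : seq nat) :
  reds P (word w) y -> exists2 w', word w' = y & P_equiv P n w w'.
Proof.
move ew: (word w) => x r; elim: r w ew => {x y} [x|x x' y r _ IH] w ew.
  by exists w => //; apply: connect0.
have : perm_eq x' (iota 1 n).
  by rewrite -(permPl (red_perm_eq r)) -ew perm_eq_word.
move/word_of_perm_eq=> [w1 ew1].
have [w' ew' ww'] := IH w1 ew1.
exists w' => //; apply: connect_trans ww'; apply: connect1.
by apply: red_step; rewrite ew ew1.
Qed.

(** A factor can be given the smallest order permutation of its part in at most
    one reduction. *)
Lemma reds_lex_minimal (c : nat) (P : {set {set 'S_c}}) (a u z b : seq nat)
    (s d : 'S_c) :
  uniq u -> perm_eq u z -> is_order_perm u s -> is_order_perm z d ->
  same_part P s d -> d \in lex_minimal P ->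
  reds P (a ++ u ++ b) (a ++ z ++ b).
Proof.
move=> uu uz us zd sd dD; have [sD|sD] := boolP (s \in lex_minimal P).
  rewrite -(lex_minimal_uniq sd sD dD) in zd.
  by rewrite (order_perm_inj uu uz us zd); apply: rt1n_refl.
by apply: red_reds; apply/Red/(Rule uz us zd sd sD dD).
Qed.

(** Two words related by one step have a common reduct: both factors can be
    given the order permutation that is the smallest of the common part. *)
Lemma step_joinable (c n : nat) (P : {set {set 'S_c}}) (w w' : 'S_n) :
  partition P [set: 'S_c] -> step P n w w' ->
  exists2 d, reds P (word w) d & reds P (word w') d.
Proof.
move=> hP /stepP[a [u [v [b [s [t [e e' us vt st]]]]]]].
have uu : uniq u.
  by have := uniq_word w; rewrite e !cat_uniq => /and3P[_ _ /andP[]].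
have uvv : uniq v.
  by have := uniq_word w'; rewrite e' !cat_uniq => /and3P[_ _ /andP[]].
have uv : perm_eq u v.
  rewrite -(perm_cat2r b) -(perm_cat2l a) -e -e'.
  by rewrite (permPl (perm_eq_word w)) perm_sym perm_eq_word.
have [d sd dD] := lex_minimal_ex s hP.
have td : same_part P t d.
  have /and3P[_ tP _] := hP.
  move: st sd; rewrite !same_part_pblock // => st.
  by rewrite (same_pblock tP st).
have [z uz zd] := rearrange d uu (size_order_perm us).
exists (a ++ z ++ b).
  by rewrite e; apply: reds_lex_minimal sd dD.
by rewrite e'; apply: reds_lex_minimal td dD => //; rewrite -(permPl uv).
Qed.

Lemma P_equiv_normal (c n : nat) (P : {set {set 'S_c}}) (w w' : 'S_n) :
  partition P [set: 'S_c] -> unique_nf P n -> P_equiv P n w w' ->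
  normal P (word w) -> normal P (word w') -> w = w'.
Proof.
move=> hP hUN ww' nw nw'.
(* equivalent words have the same normal forms *)
suff H e : normal P e -> reds P (word w) e -> reds P (word w') e.
  have r := H _ nw (rt1n_refl _ _ _).
  by apply: word_inj; rewrite (reds_normal nw' r).
case/connectP: ww' => p + ->; elim: p w {nw nw'} => //= w1 p IH w.
case/andP=> st pth ne we; apply: (IH _ pth ne).
have [d wd w1d] := step_joinable hP st.
have ud : uniq d by rewrite -(perm_uniq (reds_perm_eq wd)) uniq_word.
have [f df nf] := normal_form_ex hP ud.
have -> : e = f.
  apply: (hUN (word w)) => //; [exact: uniq_word|exact: size_word|].
  exact: reds_trans df.
exact: reds_trans df.
Qed.

(** Every class contains an avoiding permutation, so the two numbers agree
    exactly when no class contains two of them. *)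
Lemma num_classes_eq (c n : nat) (P : {set {set 'S_c}}) :
  partition P [set: 'S_c] ->
  reflect {in [pred w : 'S_n | normal P (word w)] &, forall w w',
             P_equiv P n w w' -> w = w'}
          (num_classes P n == num_avoiding (~: lex_minimal P) n).
Proof.
move=> hP; pose X := [set w : 'S_n | normal P (word w)].
pose E := equivalence_partition (P_equiv P n) [set: 'S_n].
have eqv : {in [set: 'S_n] & &, equivalence_rel (P_equiv P n)}.
  by move=> x y z _ _ _; apply: P_equiv_equivalence.
have /and3P[/eqP cE tE E0] : partition E [set: 'S_n].
  exact: equivalence_partitionP.
have mem_class (w w' : 'S_n) : (w' \in pblock E w) = P_equiv P n w w'.
  by apply: (pblock_equivalence_partition eqv); rewrite inE.
have -> : num_avoiding (~: lex_minimal P) n = #|X|.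
  by apply: eq_card => w; rewrite !inE avoids_normal.
(* every class is the class of the normal form of one of its members *)
have -> : num_classes P n = #|pblock E @: X|.
  apply: eq_card => B; apply/idP/imsetP => [BE|[w _ ->]]; last first.
    by rewrite pblock_mem // cE inE.
  have [w wB] : exists w, w \in B.
    by apply/set0Pn; apply: contraNneq E0 => <-.
  have [y wy ny] := normal_form_ex hP (uniq_word w).
  have [w' ew' ww'] := reds_P_equiv wy.
  exists w'; first by rewrite inE ew'.
  rewrite -(def_pblock tE BE wB); apply/esym/same_pblock => //.
  by rewrite mem_class.
apply: (iffP (imset_injP (f := pblock E))) => H w w' nw nw'.
  move=> ww'; apply: H; rewrite ?inE //; apply/eqP.
  by rewrite eq_pblock ?cE ?inE // mem_class.
move=> e; apply: H; [by rewrite inE in nw|by rewrite inE in nw'|].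
by rewrite -mem_class e mem_pblock cE inE.
Qed.

(** Uniqueness is known for permutations in S_k, and a word of k distinct
    letters is one of them up to an increasing renaming, which preserves
    reductions and normal forms. *)
Lemma unique_nf_of_eq (c k : nat) (P : {set {set 'S_c}}) :
  partition P [set: 'S_c] ->
  num_classes P k = num_avoiding (~: lex_minimal P) k -> unique_nf P k.
Proof.
move=> hP /eqP/(num_classes_eq _ hP) inj x y z ux sx xy xz ny nz.
(* f sends each letter of x to its rank, counted from 1 *)
pose r := sort leq x; pose f v := (index v r).+1.
have ur : uniq r by rewrite sort_uniq.
have sr : size r = k by rewrite size_sort.
have mr : r =i x by move=> i; rewrite mem_sort.
have so : sorted ltn r.
  by rewrite ltn_sorted_uniq_leq ur sort_sorted //; apply: leq_total.
have fm : {in x &, {mono f : i j / i < j}}.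
  move=> i j ix jx; rewrite /f ltnS.
  have lt := sorted_ltn_index ltn_trans so.
  case: ltngtP => [ij|ji|e]; first by rewrite lt ?mr.
    by apply/esym/negbTE; rewrite -leqNgt ltnW // lt ?mr.
  by rewrite -[i](nth_index 0 (s := r)) ?mr // e nth_index ?mr // ltnn.
have fmp t : reds P x t -> {in t &, {mono f : i j / i < j}}.
  by move/reds_perm_eq=> xt i j; rewrite -!(perm_mem xt); apply: fm.
have pf : perm_eq (map f x) (iota 1 k).
  have -> : iota 1 k = map f r.
    apply: (@eq_from_nth _ 0); first by rewrite size_map size_iota sr.
    move=> i; rewrite size_iota => li.
    by rewrite nth_iota // (nth_map 0) ?sr // /f index_uniq ?sr.
  by apply: perm_map; rewrite perm_sym perm_sort.
have [w ew] := word_of_perm_eq pf.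
have red_word t : reds P x t -> reds P (word w) (map f t).
  by move=> xt; rewrite ew; apply: reds_map.
have [w1 e1 ww1] := reds_P_equiv (red_word y xy).
have [w2 e2 ww2] := reds_P_equiv (red_word z xz).
have e12 : w1 = w2.
  apply: inj; rewrite ?inE ?e1 ?e2 ?normal_map //; [exact: fmp..|].
  by rewrite /P_equiv -(same_connect (sym_connect_sym (@step_sym c P k)) ww1).
pose g i := nth 0 r i.-1.
have gf t : reds P x t -> map g (map f t) = t.
  move/reds_perm_eq=> xt; rewrite -map_comp; apply: map_id_in => i it.
  by rewrite /= /g /f nth_index // mr (perm_mem xt).
by rewrite -(gf y xy) -(gf z xz) -e1 -e2 e12.
Qed.

Theorem theorem4p7 (c : nat) (hc : 1 <= c)
    (P : {set {set 'S_c}}) (hP : partition P [set: 'S_c])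
    (k : nat) (hk : 2 * c - 1 <= k)
    (hNA : num_classes P k = num_avoiding (~: lex_minimal P) k) :
  forall n : nat, k <= n -> num_classes P n = num_avoiding (~: lex_minimal P) n.
Proof.
move=> n kn; apply/eqP/num_classes_eq => // w w' nw nw' ww'.
apply: P_equiv_normal ww' nw nw' => //.
exact: unique_nf_ge hk (unique_nf_of_eq hP hNA) kn.
Qed.
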